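(* Let $n,\lambda,\mu$ be nonnegative integers. Then \[\sum_{k=0}^n \binom{n+\mu n}{k}\binom{n+\lambda n}{n-k} H_{\lambda n+k} = \binom{2n+\lambda n+\mu n}{n}\Big\{H_{\lambda n+n}+H_{\lambda n+\mu n+n}-H_{\lambda n+\mu n+2n}\Big\}.\]
   Context: $H_0=0$ and $H_m=\sum_{j=1}^m \frac{1}{j}$ for positive integers $m$ (classical harmonic numbers). *)

(* Defs.v *)
From mathcomp Require Import all_boot all_order all_algebra.

Set Implicit Arguments.
Unset Strict Implicit.
Unset Printing Implicit Defensive.

Import GRing.Theory.

Local Open Scope ring_scope.

Definition harmonic (m : nat) : rat := \sum_(1 <= j < m.+1) (j%:R)^-1.

(* Main.v *)
Require Import Defs.
From mathcomp Require Import all_boot all_order all_algebra.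
From mathcomp Require Import ring zify.

(** The parameters [L = lambda n] and [M = n + mu n] may be arbitrary
    naturals. Pascal's rule for [C(M+1, k)] splits the sum into the instances
    [(M, n+1, L)] and [(M, n, L+1)], and the closed form obeys the same
    recurrence because [(n+1) C(a+1, n+1) = (a+1) C(a, n)]. *)

Set Implicit Arguments.
Unset Strict Implicit.
Unset Printing Implicit Defensive.

Import GRing.Theory.

Local Open Scope ring_scope.

Lemma harmonicS m : harmonic m.+1 = harmonic m + (m.+1%:R)^-1.
Proof. by rewrite /harmonic big_nat_recr. Qed.

(** Freeing [M] and [L] from being tied to [n] is what lets the induction on [M] vary [n] and [L]
    separately. *)
Lemma harmonic_Vandermonde M n L :
  \sum_(k < n.+1) 'C(M, k)%:R * 'C(n + L, n - k)%:R * harmonic (L + k)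
  = 'C(M + n + L, n)%:R
      * (harmonic (L + n) + harmonic (L + M) - harmonic (L + M + n)).
Proof.
elim: M n L => [|M IHM] n L.
  rewrite big_ord_recl big1 => [|k _]; last by rewrite bin0n !mul0r.
  by rewrite bin0 subn0 mul1r addr0 add0n !addn0 addrAC subrr add0r.
case: n => [|n].
  by rewrite big_ord1 !bin0 !mul1r !addn0 addrK.
(* The terms at 0 agree. In the second sum [k] is shifted by one, and [n.+1 + L = n + L.+1] turns it
   into an instance of [IHM]. *)
transitivity
  (\sum_(k < n.+2) 'C(M, k)%:R * 'C(n.+1 + L, n.+1 - k)%:R * harmonic (L + k)
   + \sum_(k < n.+1) 'C(M, k)%:R * 'C(n + L.+1, n - k)%:R
       * harmonic (L.+1 + k)).
  rewrite big_ord_recl [in RHS]big_ord_recl !bin0 -addrA; congr (_ + _).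
  rewrite -big_split; apply: eq_bigr => k _ /=.
  by rewrite /bump add1n binS natrD !mulrDl subSS !addnS !addSn.
rewrite !IHM !(addnS, addSn) !harmonicS.
set a := (M + n + L)%N; have -> : (L + M + n = a)%N by lia.
rewrite [in RHS]binS natrD.
have n0 : n.+1%:R != 0 :> rat by rewrite Num.Theory.pnatr_eq0.
have a2E : a.+2%:R = n.+1%:R + (L + M).+1%:R :> rat.
  by rewrite -natrD; congr _%:R; rewrite /a; lia.
(* This leaves ['C(a.+1, n)] as the only binomial, an atom for [field]. *)
have -> : 'C(a.+1, n.+1)%:R = (L + M).+1%:R * 'C(a.+1, n)%:R / n.+1%:R :> rat.
  have : (a.+2 * 'C(a.+1, n))%:R
      = (n.+1 * ('C(a.+1, n) + 'C(a.+1, n.+1)))%:R :> rat.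
    by rewrite mul_bin_diag binS [in RHS]addnC.
  (* Splitting [a.+2] exposes [n.+1 * 'C(a.+1, n)] on both sides, where it cancels. *)
  rewrite !natrM natrD a2E mulrDl mulrDr => /addrI ->.
  by rewrite mulrC mulKf.
rewrite a2E; field.
(* Each denominator folds into the cast of a positive natural. *)
by rewrite -[1]/(1%:R) -!natrD !Num.Theory.pnatr_eq0.
Qed.

Theorem theorem1 (n lambda mu : nat) :
  \sum_(0 <= k < n.+1)
     'C(n + mu * n, k)%:R * 'C(n + lambda * n, n - k)%:R
       * harmonic (lambda * n + k)
  = 'C(2 * n + lambda * n + mu * n, n)%:R
      * (harmonic (lambda * n + n) + harmonic (lambda * n + mu * n + n)
         - harmonic (lambda * n + mu * n + 2 * n)).
Proof.
rewrite big_mkord harmonic_Vandermonde.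
by congr ('C(_, _)%:R * (_ + harmonic _ - harmonic _)); lia.
Qed.
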